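(* Let $n\le m$ and let $\mathcal{B}_{1,*}=\{X\in\mathbf{M}^{n\times m}:\|X\|_1+\|X\|_*\le 1\}$. The vertices of $\mathcal{B}_{1,*}$ are exactly the extreme points of $\tfrac12\mathcal{B}_1$, where $\mathcal{B}_1=\{X\in\mathbf{M}^{n\times m}:\|X\|_1\le1\}$; that is, they are exactly the matrices having all zero entries except for one entry whose value is $\pm\tfrac12$.
   Context: $\mathbf{M}^{n\times m}$ is the space of real $n\times m$ matrices with the trace inner product $\langle A,B\rangle=\mathrm{tr}(A^TB)$; $\|X\|_1=\sum_{i,j}|X_{i,j}|$ is the entrywise $l_1$-norm and $\|X\|_*$ is the nuclear norm (sum of singular values). A point $\bar x$ of a convex set $Q$ is a vertex of $Q$ if the normal cone $N_Q(\bar x)=\{v:\langle v,x-\bar x\rangle\le0\text{ for all }x\in Q\}$ is full-dimensional (has nonempty interior). *)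

(* Defs.v *)
From HB Require Import structures.
From mathcomp Require Import all_boot all_order all_algebra.
From mathcomp Require Import polyrcf.
From mathcomp Require Import boolp classical_sets reals topology normedtype.

Set Implicit Arguments.
Unset Strict Implicit.
Unset Printing Implicit Defensive.

Import Order.TTheory GRing.Theory Num.Theory.
Import numFieldNormedType.Exports.
Local Open Scope classical_set_scope.
Local Open Scope ring_scope.

Definition mxdot (R : realType) (n m : nat) (A B : 'M[R]_(n, m)) : R :=
  \tr (A^T *m B).

Definition l1norm (R : realType) (n m : nat) (X : 'M[R]_(n, m)) : R :=
  \sum_i \sum_j `|X i j|.

(* Square roots of the eigenvalues of X X^T, each repeated according to its
   algebraic multiplicity.  X X^T is symmetric positive semidefinite, so all n
   roots of its characteristic polynomial are real and nonnegative.  When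
   m < n this list has n - m superfluous zeros. *)
Definition singular_values (R : realType) (n m : nat) (X : 'M[R]_(n, m)) :
    seq R :=
  let p := char_poly (X *m X^T) in
  flatten [seq nseq (mup a p) (Num.sqrt a) | a <- rootsR p].

Definition nuclear_norm (R : realType) (n m : nat) (X : 'M[R]_(n, m)) : R :=
  \sum_(s <- singular_values X) s.

Definition l1_ball (R : realType) (n m : nat) : set 'M[R]_(n, m) :=
  [set X | l1norm X <= 1].

Definition l1_nuclear_ball (R : realType) (n m : nat) : set 'M[R]_(n, m) :=
  [set X | l1norm X + nuclear_norm X <= 1].

Definition normal_cone (R : realType) (n m : nat) (Q : set 'M[R]_(n, m))
    (x : 'M[R]_(n, m)) : set 'M[R]_(n, m) :=
  [set v | forall y, Q y -> mxdot v (y - x) <= 0].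

Definition vertices (R : realType) (n m : nat) (Q : set 'M[R]_(n, m)) :
    set 'M[R]_(n, m) :=
  [set x | Q x /\ interior (normal_cone Q x) !=set0].

Definition extreme_points (R : realType) (n m : nat) (Q : set 'M[R]_(n, m)) :
    set 'M[R]_(n, m) :=
  [set x | Q x /\ forall y z t, Q y -> Q z -> 0 < t < 1 ->
             x = t *: y + (1 - t) *: z -> y = x /\ z = x].

(* Main.v *)
Require Import Defs.
From mathcomp Require Import all_boot all_order all_algebra.
From mathcomp Require Import polyrcf complex.
From mathcomp Require Import ring lra.
From mathcomp Require Import boolp classical_sets reals topology normedtype.

(* The nuclear norm of X is the minimum of (|A|^2 + |B|^2) / 2 (Frobenius norms)
   over the factorizations X = A B.  Hence |X i j| <= ||X||_*, with equality for
   a matrix with a single nonzero entry, which bounds <v, y> on the ball for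
   every v close enough to +-E_ij / 2: these points are vertices.
   Conversely, let f = ||.||_1 + ||.||_*.  Freezing one factor of an optimal
   factorization X = A B gives f(X + tD) <= f(X) + c t + K t^2 for t of either
   sign, when D is a row or a column of X (completed by zeros).  If X is in the
   ball, every v in the normal cone at X is then orthogonal to D - c X, so
   D = c X when X is a vertex, and X has at most one nonzero row and at most one
   nonzero column. *)

Set Implicit Arguments.
Unset Strict Implicit.
Unset Printing Implicit Defensive.

Import Order.TTheory GRing.Theory Num.Theory.
Import numFieldNormedType.Exports.
Local Open Scope classical_set_scope.
Local Open Scope ring_scope.

(** * Spectral theorem for real symmetric matrices *)

(** Over the complex extension [S] becomes Hermitian, hence unitarily diagonalizable with real
    spectrum. A real root of the complexified characteristic polynomial is already a root of the
    original one. *)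
Lemma symmx_eigenvalue (R : rcfType) n (S : 'M[R]_n.+1) :
  S^T = S -> exists a, eigenvalue S a.
Proof.
move=> symS; pose SC := map_mx (real_complex R) S.
have hermSC : SC \is hermsymmx.
  apply: realsym_hermsym.
    apply/is_hermitianmxP; rewrite expr0 scale1r.
    by apply/matrixP => i j; rewrite !mxE -{1}symS mxE.
  by apply/mxOverP => i j; rewrite mxE; apply/complex_realP; exists (S i j).
have /orthomx_spectralP := hermitian_normalmx hermSC.
set P := spectralmx SC => defSC.
have Punit : P \in unitmx by rewrite spectral_unit.
have /mxOverP/(_ 0 0)/complex_realP[a Da] := hermitian_spectral_diag_real hermSC.
exists a; rewrite eigenvalue_root_char -(fmorph_root (real_complex R)).
rewrite map_char_poly -eigenvalue_root_char; apply/eigenvalueP.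
(* [SC] is [P^-1 D P] with [D] diagonal, so each row of [P] is a left eigenvector. *)
exists (row 0 P).
  rewrite -/SC {1}defSC !mulmxA -row_mul mulmxV // row1 -rowE.
  rewrite row_diag_mx Da -scalemxAl -rowE.
  by [].
apply/eqP => r0; have := mulmxV Punit => /(congr1 (row 0)).
rewrite row_mul r0 mul0mx => /rowP/(_ 0); rewrite !mxE eqxx => /esym/eqP.
by rewrite oner_eq0.
Qed.

Lemma mxtrace_mul_tr (R : comPzRingType) m n (A : 'M[R]_(m, n)) :
  \tr (A *m A^T) = \sum_i \sum_j A i j ^+ 2.
Proof.
by apply: eq_bigr => i _; rewrite mxE; apply: eq_bigr => j _; rewrite mxE.
Qed.

Lemma mxtrace_mul_tr_ge0 (R : realDomainType) m n (A : 'M[R]_(m, n)) :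
  0 <= \tr (A *m A^T).
Proof.
by rewrite mxtrace_mul_tr; do 2!apply: sumr_ge0 => ? _; apply: sqr_ge0.
Qed.

Lemma mxtrace_mul_tr_eq0 (R : realDomainType) m n (A : 'M[R]_(m, n)) :
  \tr (A *m A^T) = 0 -> A = 0.
Proof.
rewrite mxtrace_mul_tr => /eqP; rewrite psumr_eq0; last first.
  by move=> i _; apply: sumr_ge0 => ? _; apply: sqr_ge0.
move=> /allP A0; apply/matrixP => i j; rewrite mxE; apply/eqP.
have /= := A0 i (mem_index_enum _); rewrite psumr_eq0; last first.
  by move=> ? _; apply: sqr_ge0.
by move=> /allP/(_ j (mem_index_enum _)); rewrite /= sqrf_eq0.
Qed.

(* The Householder reflection exchanging the first basis vector e and v; when
   v = e the division by c = 0 yields 0 and the matrix is the identity. *)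
Lemma householder (R : rcfType) n (v : 'rV[R]_n.+1) : v *m v^T = 1%:M ->
  exists H : 'M[R]_n.+1, H *m H^T = 1%:M /\ row 0 H = v.
Proof.
move=> v1; pose e : 'rV[R]_n.+1 := delta_mx 0 0; pose w := v - e.
pose c := (w *m w^T) 0 0.
have Ec : c = 2 - 2 * v 0 0.
  rewrite /c /w linearB /= mulmxBl !mulmxBr v1 /e trmx_delta -colE -rowE.
  by rewrite mul_delta_mx !mxE !eqxx /=; ring.
have w1 : w *m w^T = c%:M by rewrite [LHS]mx11_scalar.
pose K := w^T *m w.
have KT : K^T = K by rewrite trmx_mul trmxK.
have KK : K *m K = c *: K.
  by rewrite /K mulmxA -(mulmxA w^T) w1 mul_mx_scalar -scalemxAl.
exists (1%:M - (2 / c) *: K); split.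
  move: (K) KT KK => {}K KT KK.
  have [c0|cn0] := eqVneq c 0.
    by rewrite c0 invr0 mulr0 scale0r subr0 trmx1 mulmx1.
  have -> : (1%:M - (2 / c) *: K)^T = 1%:M - (2 / c) *: K.
    by rewrite linearB linearZ /= trmx1 KT.
  rewrite mulmxBl mul1mx mulmxBr mulmx1.
  rewrite -scalemxAl -scalemxAr KK !scalerA.
  have -> : 2 / c * (2 / c) * c = 2 / c + 2 / c by field.
  by rewrite scalerDl; apply/matrixP=> i j; rewrite !mxE; ring.
rewrite linearB /= row1 linearZ /= row_mul.
have -> : row 0 w^T = (v 0 0 - 1)%:M.
  by apply/rowP => j; rewrite !ord1 !mxE !eqxx mulr1n.
rewrite mul_scalar_mx scalerA.
have [c0|cn0] := eqVneq c 0.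
  have : \tr (w *m w^T) = 0 by rewrite w1 c0 mxtrace_scalar mul0rn.
  move=> /mxtrace_mul_tr_eq0 wz.
  by rewrite wz scaler0 subr0; move/eqP: wz; rewrite subr_eq0 => /eqP ->.
(* Since [c = 2 - 2 * v 0 0], row 0 of the reflection is [e + w = v]. *)
have -> : 2 / c * (v 0 0 - 1) = -1.
  by apply: (mulfI cn0); rewrite mulrA mulrCA mulfV // mulr1 Ec; ring.
by rewrite scaleN1r opprK /w addrC subrK.
Qed.

(** Deflation: an orthogonal matrix with a unit eigenvector as first row conjugates [S] to a
    block-diagonal matrix, and induction handles the lower right block. *)
Lemma symmx_diagonalizable (R : rcfType) n (S : 'M[R]_n) : S^T = S ->
  exists P (d : 'rV[R]_n), P *m P^T = 1%:M /\ P *m S *m P^T = diag_mx d.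
Proof.
elim: n S => [|n IHn] S symS.
  by exists 0, 0; split; apply/matrixP=> -[].
have [a /eigenvalueP[u uS u0]] := symmx_eigenvalue symS.
pose q := \tr (u *m u^T).
have q0 : 0 < q.
  rewrite lt_def mxtrace_mul_tr_ge0 andbT; apply: contra u0 => /eqP.
  by move/mxtrace_mul_tr_eq0 => ->.
pose v := (Num.sqrt q)^-1 *: u.
have v1 : v *m v^T = 1%:M.
  rewrite linearZ /= -scalemxAl -scalemxAr scalerA -invfM -expr2 sqr_sqrtr ?ltW //.
  rewrite [u *m _]mx11_scalar -trace_mx11 -/q -scalemx1 scalerA mulVf ?gt_eqF //.
  by rewrite scale1r.
have vS : v *m S = a *: v by rewrite -scalemxAl uS !scalerA mulrC.
have [H [H1 Hv]] := householder v1.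
(* [T] is made opaque and typed in dimension [1 + n], so that the block projections apply to it. *)
have [T DT] : {T : 'M[R]_(1 + n) | T = H *m S *m H^T} by exists (H *m S *m H^T).
have symT : T^T = T by rewrite DT !trmx_mul trmxK symS mulmxA.
have rT : row 0 T = a *: delta_mx 0 0.
  rewrite DT !row_mul Hv vS -scalemxAl -Hv -row_mul H1.
  by rewrite row1.
have uT : ursubmx T = 0.
  apply/rowP => j; rewrite !mxE.
  transitivity (T 0 (rshift 1 j)); first by congr (T _ _); apply: val_inj.
  have /rowP/(_ (rshift 1 j)) := rT; rewrite [LHS]mxE => ->.
  by rewrite !mxE eqxx /= mulr0.
have dT : dlsubmx T = 0 by rewrite -[T]symT -trmx_ursub uT trmx0.
have [|P [d [P1 PS]]] := IHn (drsubmx T); first by rewrite trmx_drsub symT.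
pose B : 'M[R]_(1 + n) := block_mx 1%:M 0 0 P.
pose e : 'rV[R]_(1 + n) := row_mx a%:M d.
have B1 : B *m B^T = 1%:M.
  rewrite /B tr_block_mx mulmx_block !trmx0 trmx1 !mulmx0 !mul0mx.
  rewrite !add0r !addr0 P1 mulmx1.
  by rewrite -scalar_mx_block.
have BT : B *m T *m B^T = diag_mx e.
  rewrite -[T]submxK uT dT /B tr_block_mx !mulmx_block !trmx0 trmx1.
  rewrite !mulmx0 !mul0mx !add0r !addr0 !mulmx1 !mul1mx PS diag_mx_row mul0mx.
  congr block_mx; rewrite [LHS]mx11_scalar [RHS]mx11_scalar; congr _%:M.
  transitivity (T 0 0); first by rewrite !mxE; congr (T _ _); apply: val_inj.
  by have /rowP/(_ 0) := rT; rewrite !mxE !eqxx mulr1 mulr1n.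
exists (B *m H), e; split.
  by rewrite trmx_mul !mulmxA -(mulmxA B) H1 mulmx1.
by rewrite -BT DT trmx_mul !mulmxA.
Qed.

(** * The nuclear norm read off an orthogonal diagonalization *)

Lemma char_poly_orthogonal_conj (R : comNzRingType) n (P S : 'M[R]_n) :
  P *m P^T = 1%:M -> char_poly (P *m S *m P^T) = char_poly S.
Proof.
move=> P1; pose Q := map_mx polyC P.
have Q1 : Q *m Q^T = 1%:M by rewrite /Q map_trmx -map_mxM P1 map_mx1.
rewrite /char_poly.
have -> : char_poly_mx (P *m S *m P^T) = Q *m char_poly_mx S *m Q^T.
  rewrite /char_poly_mx !map_mxM -map_trmx -/Q mulmxBr mulmxBl.
  by rewrite mul_mx_scalar -scalemxAl Q1 scalemx1.
by rewrite !det_mulmx mulrAC -det_mulmx Q1 det1 mul1r.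
Qed.

(** Links the encoding of [singular_values], distinct roots repeated by multiplicity, to a plain sum
    over a list of roots: [mup a p] counts the occurrences of [a] in [s]. *)
Lemma sum_rootsR_mup (R : rcfType) (f : R -> R) (s : seq R) :
  let p := \prod_(a <- s) ('X - a%:P) in
  \sum_(b <- flatten [seq nseq (mup a p) (f a) | a <- rootsR p]) b
    = \sum_(a <- s) f a.
Proof.
move=> p; have p0 : p != 0 by apply/monic_neq0/monic_prod_XsubC.
rewrite big_flatten /= big_map -(big_undup_iterop_count _ s).
rewrite (perm_big (undup s)) /=; last first.
  apply: uniq_perm; rewrite ?undup_uniq ?uniq_roots // => a.
  have := roots_on_rootsR p0 a; rewrite in_itv /= => <-.
  by rewrite mem_undup root_prod_XsubC.
by apply: eq_bigr => a _; rewrite big_nseq iter_addr_0 mu_prod_XsubC.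
Qed.

Lemma nuclear_norm_diag (R : realType) n m (X : 'M[R]_(n, m)) (P : 'M_n)
    (d : 'rV_n) :
  P *m P^T = 1%:M -> P *m (X *m X^T) *m P^T = diag_mx d ->
  nuclear_norm X = \sum_k Num.sqrt (d 0 k).
Proof.
move=> P1 PX; rewrite /nuclear_norm /singular_values.
have -> : char_poly (X *m X^T) = \prod_(a <- [seq d 0 k | k : 'I_n]) ('X - a%:P).
  rewrite -(char_poly_orthogonal_conj _ P1) PX char_poly_trig ?diag_mx_is_trig //.
  by rewrite big_image; apply: eq_bigr => k _; rewrite mxE eqxx mulr1n.
by rewrite sum_rootsR_mup big_image.
Qed.

(** This is a singular value decomposition with unnormalized right factor: the rows of [P *m X] are
    orthogonal and their squared lengths are the entries of [d]. *)
Lemma nuclear_norm_spectral (R : realType) n m (X : 'M[R]_(n, m)) :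
  exists (P : 'M_n) (d : 'rV_n), [/\ P *m P^T = 1%:M,
    P *m X *m (P *m X)^T = diag_mx d, forall k, 0 <= d 0 k &
    nuclear_norm X = \sum_k Num.sqrt (d 0 k)].
Proof.
have [|P [d [P1 PX]]] := symmx_diagonalizable (S := X *m X^T).
  by rewrite trmx_mul trmxK.
have PX' : P *m X *m (P *m X)^T = diag_mx d by rewrite -PX trmx_mul !mulmxA.
exists P, d; split => //; last exact: nuclear_norm_diag PX.
move=> k; have /matrixP/(_ k k) := PX'; rewrite [RHS]mxE eqxx mulr1n => <-.
by rewrite mxE sumr_ge0 // => j _; rewrite [_^T _ _]mxE -expr2 sqr_ge0.
Qed.

(** * The nuclear norm as a minimum over factorizations *)

Lemma row_eq0_gram (R : realDomainType) n m (Y : 'M[R]_(n, m)) (d : 'rV_n) k :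
  Y *m Y^T = diag_mx d -> d 0 k = 0 -> row k Y = 0.
Proof.
move=> /matrixP/(_ k k); rewrite !mxE eqxx mulr1n => <- Y0.
apply: mxtrace_mul_tr_eq0; rewrite trace_mx11 -[RHS]Y0 mxE.
by apply: eq_bigr => j _; rewrite !mxE.
Qed.

Lemma diag_mx_mul_eq (R : comPzRingType) n m (c : 'rV[R]_n) (Y : 'M[R]_(n, m)) :
  (forall k, c 0 k = 1 \/ row k Y = 0) -> diag_mx c *m Y = Y.
Proof.
move=> cY; apply/row_matrixP => k; rewrite row_mul row_diag_mx -scalemxAl -rowE.
by case: (cY k) => ->; rewrite ?scale1r // scaler0.
Qed.

(** With [Y = P *m X] and [s] the square roots of the singular values, [X] is [P^T diag(s)] times
    [diag(s)^-1 Y]. Both factors have squared Frobenius norm equal to the sum of the singular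
    values. *)
Lemma nuclear_norm_factor (R : realType) n m (X : 'M[R]_(n, m)) :
  exists (A : 'M_n) (B : 'M_(n, m)), X = A *m B /\
    (\tr (A *m A^T) + \tr (B *m B^T)) / 2 = nuclear_norm X.
Proof.
have [P [d [P1 PX d0 ->]]] := nuclear_norm_spectral X.
have X_PX : X = P^T *m (P *m X) by rewrite mulmxA (mulmx1C P1) mul1mx.
move: (P *m X) X_PX PX => Y X_Y YY.
have [s sE] : exists s : 'rV[R]_n, forall k, s 0 k = Num.sqrt (Num.sqrt (d 0 k)).
  by exists (\row_k Num.sqrt (Num.sqrt (d 0 k))) => k; rewrite mxE.
have ss k : s 0 k ^+ 2 = Num.sqrt (d 0 k) by rewrite sE sqr_sqrtr ?sqrtr_ge0.
have sd k : (s 0 k ^+ 2) ^+ 2 = d 0 k by rewrite ss sqr_sqrtr.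
have [r rE] : exists r : 'rV[R]_n, forall k, r 0 k = (s 0 k)^-1.
  by exists (\row_k (s 0 k)^-1) => k; rewrite mxE.
exists (P^T *m diag_mx s), (diag_mx r *m Y); split.
  rewrite mulmxA -(mulmxA P^T) mulmx_diag -mulmxA diag_mx_mul_eq // => k.
  (* At a zero singular value [r] is 0 by the convention on inverses, and the corresponding row of
     [Y] vanishes. *)
  have [dk0|dk0] := eqVneq (d 0 k) 0; [right; exact: row_eq0_gram YY dk0|left].
  rewrite mxE rE mulfV //.
  by apply: contra dk0 => /eqP s0; rewrite -sd s0 !expr0n.
rewrite !trmx_mul !tr_diag_mx trmxK mxtrace_mulC !mulmxA -(mulmxA _ P) P1 mulmx1.
rewrite -(mulmxA (diag_mx r)) YY !mulmx_diag !mxtrace_diag.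
rewrite -big_split mulr_suml; apply: eq_bigr => k _ /=.
rewrite -ss !mxE rE -sd.
have [->|s0] := eqVneq (s 0 k) 0; [by rewrite invr0; ring | by field].
Qed.

(** The sum of the singular values is [<W, P A B> = <W B^T, P A>] for a partial isometry [W]. Then
    [2 <M, N> <= |M|^2 + |N|^2], where [|W B^T| <= |B|] and [|P A| = |A|]. *)
Lemma nuclear_norm_mul_le (R : realType) n m k (A : 'M[R]_(n, k))
    (B : 'M_(k, m)) :
  nuclear_norm (A *m B) <= (\tr (A *m A^T) + \tr (B *m B^T)) / 2.
Proof.
have [P [d [P1 PX d0 ->]]] := nuclear_norm_spectral (A *m B).
have : P *m (A *m B) = (P *m A) *m B by rewrite mulmxA.
move: (P *m (A *m B)) PX => Y YY YE.
have [r rE] : exists r : 'rV[R]_n, forall l, r 0 l = (Num.sqrt (d 0 l))^-1.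
  by exists (\row_l (Num.sqrt (d 0 l))^-1) => l; rewrite mxE.
(* W is the partial isometry in the polar decomposition of A *m B (in the basis
   P): its Gram matrix is a projection, so composing with W decreases |B|. *)
pose W := diag_mx r *m Y.
have sE l : d 0 l != 0 ->
    exists2 s, s != 0 & Num.sqrt (d 0 l) = s /\ d 0 l = s ^+ 2.
  move=> dl0; exists (Num.sqrt (d 0 l)); last by rewrite sqr_sqrtr.
  by rewrite sqrtr_eq0 -ltNge lt_def dl0 d0.
have WW : W *m W^T *m W = W.
  rewrite /W trmx_mul tr_diag_mx !mulmxA -(mulmxA _ Y) YY !mulmx_diag.
  congr (diag_mx _ *m _); apply/rowP => l; rewrite !mxE rE.
  have [->|dl0] := eqVneq (d 0 l) 0; first by rewrite sqrtr0 invr0 !mul0r.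
  by have [s s0 [-> ->]] := sE _ dl0; field.
have WQ : W^T *m W *m (W^T *m W) = W^T *m W by rewrite -mulmxA (mulmxA W) WW.
have -> : \sum_l Num.sqrt (d 0 l) = \tr (W *m Y^T).
  rewrite /W -mulmxA YY mulmx_diag mxtrace_diag.
  apply: eq_bigr => l _; rewrite mxE rE.
  have [->|dl0] := eqVneq (d 0 l) 0; first by rewrite sqrtr0 mulr0.
  by have [s s0 [-> ->]] := sE _ dl0; field.
have leB : \tr (W *m B^T *m (W *m B^T)^T) <= \tr (B *m B^T).
  have -> : \tr (W *m B^T *m (W *m B^T)^T) = \tr (B *m (W^T *m W) *m B^T).
    by rewrite [LHS]mxtrace_mulC trmx_mul trmxK !mulmxA.
  have : (W^T *m W)^T = W^T *m W by rewrite trmx_mul trmxK.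
  move: (W^T *m W) WQ => Q QQ QT.
  (* [Q] is an orthogonal projection, so [|B - B Q|^2] expands to the difference of the two traces
     to be compared. *)
  have := mxtrace_mul_tr_ge0 (B - B *m Q).
  have -> : (B - B *m Q)^T = B^T - Q *m B^T by rewrite linearB /= trmx_mul QT.
  rewrite mulmxBl !mulmxBr !mulmxA -(mulmxA B Q Q) QQ subrr subr0.
  by rewrite linearB subr_ge0.
have trA : \tr (P *m A *m (P *m A)^T) = \tr (A *m A^T).
  rewrite mxtrace_mulC trmx_mul !mulmxA -(mulmxA _ P^T) (mulmx1C P1) mulmx1.
  exact: mxtrace_mulC.
have trY : \tr (W *m Y^T) = \tr (W *m B^T *m (P *m A)^T).
  by rewrite YE [in LHS]trmx_mul mulmxA.
have := mxtrace_mul_tr_ge0 (W *m B^T - P *m A).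
rewrite trY; move: (W *m B^T) (P *m A) leB trA => M N leM trN.
have -> : (M - N)^T = M^T - N^T by rewrite linearB.
rewrite mulmxBl !mulmxBr !linearB /= trN.
have -> : \tr (N *m M^T) = \tr (M *m N^T) by rewrite -mxtrace_tr trmx_mul trmxK.
lra.
Qed.

Lemma mxtrace_mul_trZ (R : comPzRingType) n m (a : R) (A : 'M[R]_(n, m)) :
  \tr ((a *: A) *m (a *: A)^T) = a ^+ 2 * \tr (A *m A^T).
Proof. by rewrite linearZ /= -scalemxAl -scalemxAr scalerA mxtraceZ. Qed.

(** Each factor of an optimal factorization absorbs the square root of [|c|]; the second one also
    takes the sign. *)
Lemma nuclear_normZ_le (R : realType) n m (c : R) (X : 'M[R]_(n, m)) :
  nuclear_norm (c *: X) <= `|c| * nuclear_norm X.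
Proof.
have [A [B [-> <-]]] := nuclear_norm_factor X.
pose a := Num.sqrt `|c|.
have a2 : a ^+ 2 = `|c| by rewrite sqr_sqrtr.
have -> : c *: (A *m B) = (a *: A) *m ((Num.sg c * a) *: B).
  by rewrite -scalemxAl -scalemxAr scalerA mulrCA -expr2 a2 -numEsg.
apply: le_trans (nuclear_norm_mul_le _ _) _.
rewrite !mxtrace_mul_trZ exprMn a2 sqr_sg mulrA mulrDr.
rewrite ler_pM2r ?invr_gt0 ?ltr0n //.
rewrite lerD2l ler_wpM2r ?mxtrace_mul_tr_ge0 // ler_piMl //.
(* The squared sign of [c] is the boolean [c != 0] read as a number, hence at most 1. *)
by case: (c != 0).
Qed.

(** In an optimal factorization the entry is the product of a row of [A] and a column of [B]; the
    bound is the arithmetic-geometric inequality, term by term. *)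
Lemma norm_le_nuclear_norm (R : realType) n m (X : 'M[R]_(n, m)) i j :
  `|X i j| <= nuclear_norm X.
Proof.
have [A [B [-> <-]]] := nuclear_norm_factor X.
have leA : \sum_k A i k ^+ 2 <= \tr (A *m A^T).
  rewrite mxtrace_mul_tr [leRHS](bigD1 i) //= lerDl.
  by do 2!apply: sumr_ge0 => ? _; apply: sqr_ge0.
have leB : \sum_k B k j ^+ 2 <= \tr (B *m B^T).
  rewrite mxtrace_mul_tr; apply: ler_sum => k _.
  by rewrite (bigD1 j) //= lerDl; apply: sumr_ge0 => ? _; apply: sqr_ge0.
suff: `|(A *m B) i j| <= (\sum_k A i k ^+ 2 + \sum_k B k j ^+ 2) / 2 by lra.
rewrite mxE -big_split mulr_suml; apply: le_trans (ler_norm_sum _ _ _) _.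
apply: ler_sum => k _ /=; rewrite normrM -(real_normK (num_real (A i k))).
rewrite -(real_normK (num_real (B k j))).
move: `|A i k| `|B k j| => a b; have := sqr_ge0 (a - b); rewrite sqrrB; lra.
Qed.

(** The left factor alone absorbs the perturbation, as [(A + t E A) B], so the factorization bound
    is a quadratic in [t], exact at [t = 0]. This gives a smooth upper bound on both sides of 0. *)
Lemma nuclear_norm_mull_perturb (R : realType) n m (E : 'M[R]_n)
    (X : 'M_(n, m)) :
  exists c K : R, forall t,
    nuclear_norm (X + t *: (E *m X)) <= nuclear_norm X + c * t + K * t ^+ 2.
Proof.
have [A [B [-> <-]]] := nuclear_norm_factor X.
exists (\tr (A *m (E *m A)^T)), (\tr ((E *m A) *m (E *m A)^T) / 2) => t.
have -> : A *m B + t *: (E *m (A *m B)) = (A + t *: (E *m A)) *m B.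
  by rewrite mulmxDl -scalemxAl mulmxA.
apply: le_trans (nuclear_norm_mul_le _ _) _.
move: (E *m A) => D.
have -> : (A + t *: D)^T = A^T + t *: D^T by rewrite linearD linearZ.
rewrite mulmxDl !mulmxDr -!scalemxAl -!scalemxAr scalerA !mxtraceD !mxtraceZ.
have -> : \tr (D *m A^T) = \tr (A *m D^T) by rewrite -mxtrace_tr trmx_mul trmxK.
lra.
Qed.

(** Mirror image, with the perturbation absorbed by the right factor. *)
Lemma nuclear_norm_mulr_perturb (R : realType) n m (E : 'M[R]_m)
    (X : 'M_(n, m)) :
  exists c K : R, forall t,
    nuclear_norm (X + t *: (X *m E)) <= nuclear_norm X + c * t + K * t ^+ 2.
Proof.
have [A [B [-> <-]]] := nuclear_norm_factor X.
exists (\tr (B *m (B *m E)^T)), (\tr ((B *m E) *m (B *m E)^T) / 2) => t.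
have -> : A *m B + t *: (A *m B *m E) = A *m (B + t *: (B *m E)).
  by rewrite mulmxDr -scalemxAr mulmxA.
apply: le_trans (nuclear_norm_mul_le _ _) _.
move: (B *m E) => D.
have -> : (B + t *: D)^T = B^T + t *: D^T by rewrite linearD linearZ.
rewrite mulmxDl !mulmxDr -!scalemxAl -!scalemxAr scalerA !mxtraceD !mxtraceZ.
have -> : \tr (D *m B^T) = \tr (B *m D^T) by rewrite -mxtrace_tr trmx_mul trmxK.
lra.
Qed.

(** * Inner product, entrywise norm and single-entry matrices *)

Lemma l1norm_pair (R : realType) n m (X : 'M[R]_(n, m)) :
  l1norm X = \sum_p `|X p.1 p.2|.
Proof. by rewrite /l1norm pair_bigA. Qed.

Lemma mxdotE (R : realType) n m (A B : 'M[R]_(n, m)) :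
  mxdot A B = \sum_p A p.1 p.2 * B p.1 p.2.
Proof.
rewrite -(pair_bigA _ (fun i j => A i j * B i j)) exchange_big /=.
by apply: eq_bigr => j _; rewrite mxE; apply: eq_bigr => i _; rewrite mxE.
Qed.

Lemma mxdotDr (R : realType) n m (v A B : 'M[R]_(n, m)) :
  mxdot v (A + B) = mxdot v A + mxdot v B.
Proof. by rewrite /mxdot mulmxDr mxtraceD. Qed.

Lemma mxdotZr (R : realType) n m c (v A : 'M[R]_(n, m)) :
  mxdot v (c *: A) = c * mxdot v A.
Proof. by rewrite /mxdot -scalemxAr mxtraceZ. Qed.

Lemma mxdotBr (R : realType) n m (v A B : 'M[R]_(n, m)) :
  mxdot v (A - B) = mxdot v A - mxdot v B.
Proof. by rewrite -scaleN1r mxdotDr mxdotZr mulN1r. Qed.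

Lemma l1normZ (R : realType) n m (c : R) (X : 'M[R]_(n, m)) :
  l1norm (c *: X) = `|c| * l1norm X.
Proof.
by rewrite !l1norm_pair mulr_sumr; apply: eq_bigr => p _; rewrite mxE normrM.
Qed.

Lemma l1norm_ge (R : realType) n m (X : 'M[R]_(n, m)) i j :
  `|X i j| <= l1norm X.
Proof.
by rewrite l1norm_pair (bigD1 (i, j)) //= lerDl; apply: sumr_ge0.
Qed.

Lemma l1norm_ge2 (R : realType) n m (X : 'M[R]_(n, m)) i j k l :
  (k, l) != (i, j) -> `|X i j| + `|X k l| <= l1norm X.
Proof.
move=> neq; rewrite l1norm_pair (bigD1 (i, j)) //= lerD2l (bigD1 (k, l)) //=.
by rewrite lerDl; apply: sumr_ge0.
Qed.

(** Every entry is either kept or multiplied by [1 + t], which is nonnegative, so no sign changes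
    and the dependence on [t] is exactly affine. *)
Lemma l1norm_perturb (R : realType) n m (X D : 'M[R]_(n, m)) t :
  (forall k l, D k l = X k l \/ D k l = 0) -> `|t| <= 1 ->
  l1norm (X + t *: D) = l1norm X + t * l1norm D.
Proof.
move=> DX t1; rewrite !l1norm_pair mulr_sumr -big_split.
apply: eq_bigr => -[k l] _ /=.
rewrite !mxE; case: (DX k l) => ->; last by rewrite normr0 !mulr0 !addr0.
have : 0 <= 1 + t by move: t1; rewrite ler_norml; lra.
by rewrite -[X in `|X + _|]mul1r -mulrDl normrM => /ger0_norm ->; ring.
Qed.

Lemma l1norm_single (R : realType) n m (X : 'M[R]_(n, m)) i j :
  (forall k l, (k, l) != (i, j) -> X k l = 0) -> l1norm X = `|X i j|.
Proof.
move=> X0; rewrite l1norm_pair (bigD1 (i, j)) //= big1 ?addr0 // => -[k l] /= kl.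
by rewrite X0 ?normr0.
Qed.

(** A unit column times a unit row is a factorization with inner dimension 1. *)
Lemma nuclear_norm_delta_le (R : realType) n m (i : 'I_n) (j : 'I_m) :
  nuclear_norm (delta_mx i j : 'M[R]_(n, m)) <= 1.
Proof.
have := nuclear_norm_mul_le (delta_mx i (0 : 'I_1)) (delta_mx 0 j : 'M[R]_(1, m)).
rewrite mul_delta_mx !trmx_delta !mul_delta_mx.
have tr1 p (k : 'I_p) : \tr (delta_mx k k : 'M[R]_p) = 1.
  rewrite /mxtrace (bigD1 k) //= mxE eqxx big1 ?addr0 // => l /negPf lk.
  by rewrite mxE lk.
by rewrite !tr1; lra.
Qed.

Lemma nuclear_norm_single_le (R : realType) n m (X : 'M[R]_(n, m)) i j :
  (forall k l, (k, l) != (i, j) -> X k l = 0) -> nuclear_norm X <= `|X i j|.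
Proof.
move=> X0; have XE : X = X i j *: delta_mx i j.
  apply/matrixP => k l; rewrite !mxE.
  have [[-> ->]|kl] := eqVneq (k, l) (i, j); first by rewrite !eqxx mulr1.
  by rewrite X0 //; move: kl; rewrite xpair_eqE => /negPf ->; rewrite mulr0.
rewrite {1}XE; apply: le_trans (nuclear_normZ_le _ _) _.
by rewrite ler_piMr // nuclear_norm_delta_le.
Qed.

(** * First-order conditions in the normal cone and at a vertex *)

Lemma quadratic_bound_eq0 (R : realFieldType) (a b e : R) : 0 < e ->
  (forall t, `|t| <= e -> t * a <= b * t ^+ 2) -> a = 0.
Proof.
move=> e0 H; apply/eqP/negPn/negP => a0.
(* The test point is [t = a / M]: [M >= |a| / e] keeps it in range, and [M > b] makes the linear
   term win. *)
pose M := `|b| + 1 + `|a| / e.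
have ae : 0 <= `|a| / e by rewrite divr_ge0 // ltW.
have bM : b < M by rewrite /M; have := ler_norm b; lra.
have M0 : 0 < M by rewrite /M; have := normr_ge0 b; lra.
have /H : `|M^-1 * a| <= e.
  rewrite normrM gtr0_norm ?invr_gt0 // mulrC ler_pdivrMr // /M.
  rewrite mulrDr [e * (_ / _)]mulrC divfK ?gt_eqF // lerDr mulr_ge0 ?(ltW e0) //.
  by rewrite addr_ge0.
have a2 : 0 < a ^+ 2 by rewrite lt_def sqrf_eq0 a0 sqr_ge0.
have : 0 < M^-1 * a ^+ 2 * (1 - b * M^-1).
  apply: mulr_gt0; first by rewrite mulr_gt0 ?invr_gt0.
  by rewrite subr_gt0 ltr_pdivrMr // mul1r.
lra.
Qed.

(** Dividing [x + t D] by [s = 1 + c t + K t^2] lands in the ball. The normal cone inequality there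
    reads [t <v, D - c x> <= K t^2 <v, x>], and both signs of [t] are allowed. *)
Lemma normal_cone_tangent (R : realType) n m (x D v : 'M[R]_(n, m)) c K :
  normal_cone (@l1_nuclear_ball R n m) x v ->
  (forall t, `|t| <= 1 ->
     l1norm (x + t *: D) + nuclear_norm (x + t *: D) <= 1 + c * t + K * t ^+ 2) ->
  mxdot v (D - c *: x) = 0.
Proof.
move=> Nv H; pose M := `|c| + `|K| + 1.
have M1 : 1 <= M by rewrite /M; have := normr_ge0 c; have := normr_ge0 K; lra.
(* For [|t| <= 1 / (2 M)] the terms [c t] and [K t^2] together stay below 1/2 in absolute value, so
   [s] is positive. *)
apply: (@quadratic_bound_eq0 _ _ (K * mxdot v x) (2 * M)^-1).
  by rewrite invr_gt0; lra.
move=> t tM; pose s := 1 + c * t + K * t ^+ 2.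
have tM1 : `|t| * (2 * M) <= 1 by rewrite -ler_pdivlMr ?div1r //; lra.
have t1 : `|t| <= 1 by apply: le_trans tM _; rewrite invf_le1; lra.
have s0 : 0 < s.
  have h1 : - (`|c| * `|t|) <= c * t by rewrite -normrM lerNl -normrN ler_norm.
  have h2 : - (`|K| * `|t|) <= K * t ^+ 2.
    rewrite lerNl; apply: (le_trans (ler_norm _)); rewrite normrN normrM normrX.
    by rewrite ler_wpM2l // expr2 ler_piMr.
  move: tM1; rewrite /M /s; have := normr_ge0 t; lra.
have By : (@l1_nuclear_ball R n m) (s^-1 *: (x + t *: D)).
  rewrite /l1_nuclear_ball /= l1normZ.
  have := nuclear_normZ_le s^-1 (x + t *: D).
  have := H t t1; rewrite -/s gtr0_norm ?invr_gt0 // => h1 h2.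
  apply: le_trans (lerD (lexx _) h2) _.
  by rewrite -mulrDr mulrC ler_pdivrMr // mul1r.
have := Nv _ By; rewrite !mxdotBr !mxdotZr mxdotDr mxdotZr.
rewrite subr_le0 mulrC ler_pdivrMr // /s; lra.
Qed.

(** A whole ball of normal vectors is orthogonal to [Z = D - c x]. Moving its center along [Z] shows
    that [Z] is orthogonal to itself. *)
Lemma vertices_tangent (R : realType) n m (x D : 'M[R]_(n, m)) c K :
  vertices (@l1_nuclear_ball R n m) x ->
  (forall t, `|t| <= 1 ->
     l1norm (x + t *: D) + nuclear_norm (x + t *: D) <= 1 + c * t + K * t ^+ 2) ->
  D = c *: x.
Proof.
move=> [_ [v0 /nbhs_ballP[e /= e0 Ne]]] H.
have Z0 v : ball v0 e v -> mxdot v (D - c *: x) = 0.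
  by move=> /Ne Nv; apply: normal_cone_tangent Nv H.
apply/eqP; rewrite -subr_eq0; apply/eqP; move: (D - c *: x) Z0 => Z Z0.
have l0 : 0 < 1 + l1norm Z by rewrite ltr_pwDl // l1norm_pair sumr_ge0.
(* Balls of matrices are entrywise, and no entry of [Z] exceeds [l1norm Z], so [h *: Z] is a
   displacement smaller than [e]. *)
pose h := e / (1 + l1norm Z).
have h0 : 0 < h by rewrite divr_gt0.
have : mxdot (v0 + h *: Z) Z = 0.
  apply: Z0; split=> // i j; rewrite /ball /= !mxE opprD addNKr.
  rewrite normrN normrM gtr0_norm //.
  rewrite /h mulrAC ltr_pdivrMr // ltr_pM2l //.
  by rewrite (le_lt_trans (l1norm_ge Z i j)) // ltrDr.
rewrite /mxdot linearD /= linearZ /= mulmxDl -scalemxAl mxtraceD mxtraceZ.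
rewrite -/(mxdot v0 Z) Z0; last exact: ballxx.
rewrite add0r => /eqP; rewrite mulf_eq0 gt_eqF //= => /eqP.
rewrite /mxdot -{2}[Z]trmxK => /mxtrace_mul_tr_eq0 /(congr1 trmx).
by rewrite trmxK trmx0.
Qed.

(** * Facts on scalars and entries *)

Lemma norm_eq_half (R : realFieldType) (a : R) :
  `|a| = 2^-1 <-> a = 2^-1 \/ a = - 2^-1.
Proof.
split=> [h|]; last by case=> ->; rewrite ?normrN gtr0_norm // invr_gt0.
have [a0|a0] := lerP 0 a; first by left; rewrite -h ger0_norm.
by right; rewrite -h ltr0_norm // opprK.
Qed.

Lemma convex_comb_eq_ub (R : realFieldType) (y z s t : R) :
  y <= s -> z <= s -> 0 < t < 1 -> t * y + (1 - t) * z = s -> y = s /\ z = s.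
Proof.
move=> ys zs /andP[t0 t1] ts.
have hy : 0 <= t * (s - y) by apply: mulr_ge0; lra.
have hz : 0 <= (1 - t) * (s - z) by apply: mulr_ge0; lra.
have : t * (s - y) = 0 by lra.
have : (1 - t) * (s - z) = 0 by lra.
move=> /eqP; rewrite mulf_eq0 gt_eqF ?subr_gt0 //= subr_eq0 => /eqP <-.
by move=> /eqP; rewrite mulf_eq0 gt_eqF //= subr_eq0 => /eqP <-.
Qed.

Lemma mx_neq0_entry (R : nmodType) n m (x : 'M[R]_(n, m)) :
  x != 0 -> exists i j, x i j != 0.
Proof.
move=> nz; apply: contrapT => /forallNP xN; case/eqP: nz.
apply/matrixP => i j; rewrite mxE; apply/eqP/negPn/negP => xij.
by apply: (xN i); exists j.
Qed.

(** * Shape of the vertices of the ball *)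

(** The tangent direction is row [i] of [x] completed by zeros. It must be a multiple of [x]; the
    nonzero entry [x i j] forces the factor 1, so the other rows vanish. *)
Lemma vertices_row (R : realType) n m (x : 'M[R]_(n, m)) i j k l :
  vertices (@l1_nuclear_ball R n m) x -> x i j != 0 -> k != i -> x k l = 0.
Proof.
move=> Vx xij ki; have Bx : l1norm x + nuclear_norm x <= 1 by case: Vx.
have [c [K H]] := nuclear_norm_mull_perturb (delta_mx i i) x.
have DE p q : (delta_mx i i *m x) p q = if p == i then x i q else 0.
  rewrite mxE (bigD1 i) //= big1 ?addr0 => [|r /negPf ri]; last first.
    by rewrite mxE ri andbF mul0r.
  by rewrite mxE eqxx andbT; case: (p == i); rewrite ?mul1r ?mul0r.
have /matrixP xD : delta_mx i i *m x = (c + l1norm (delta_mx i i *m x)) *: x.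
  apply: (vertices_tangent (K := K) Vx) => t t1; rewrite l1norm_perturb //.
    by have := H t; lra.
  by move=> p q; rewrite DE; case: eqP => [->|_]; [left|right].
have := xD i j; rewrite DE eqxx mxE -[LHS]mul1r => /(mulIf xij) c1.
by have := xD k l; rewrite DE (negPf ki) mxE -c1 mul1r.
Qed.

Lemma vertices_col (R : realType) n m (x : 'M[R]_(n, m)) i j k l :
  vertices (@l1_nuclear_ball R n m) x -> x i j != 0 -> l != j -> x k l = 0.
Proof.
move=> Vx xij lj; have Bx : l1norm x + nuclear_norm x <= 1 by case: Vx.
have [c [K H]] := nuclear_norm_mulr_perturb (delta_mx j j) x.
have DE p q : (x *m delta_mx j j) p q = if q == j then x p j else 0.
  rewrite mxE (bigD1 j) //= big1 ?addr0 => [|r /negPf ri]; last first.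
    by rewrite mxE ri mulr0.
  by rewrite mxE eqxx; case: (q == j); rewrite ?mulr1 ?mulr0.
have /matrixP xD : x *m delta_mx j j = (c + l1norm (x *m delta_mx j j)) *: x.
  apply: (vertices_tangent (K := K) Vx) => t t1; rewrite l1norm_perturb //.
    by have := H t; lra.
  by move=> p q; rewrite DE; case: eqP => [->|_]; [left|right].
have := xD i j; rewrite DE eqxx mxE -[LHS]mul1r => /(mulIf xij) c1.
by have := xD k l; rewrite DE (negPf lj) mxE -c1 mul1r.
Qed.

(** At 0 the direction [D = delta_mx 0 0] satisfies the tangent bound with [c = 0] and [K = 1],
    because [2 |t| <= 1 + t^2]; a vertex at 0 would force [D = 0]. *)
Lemma vertices_neq0 (R : realType) n m (x : 'M[R]_(n, m)) :
  (0 < n)%N -> (0 < m)%N -> vertices (@l1_nuclear_ball R n m) x -> x != 0.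
Proof.
case: n m x => [|n] [|m] // x _ _ Vx; apply/eqP => x0; rewrite {}x0 in Vx.
pose D : 'M[R]_(n.+1, m.+1) := delta_mx 0 0.
have H t : `|t| <= 1 -> l1norm (0 + t *: D) + nuclear_norm (0 + t *: D) <=
    1 + 0 * t + 1 * t ^+ 2.
  move=> _; rewrite add0r mul0r addr0 mul1r.
  set X := t *: _; have X0 k l : (k, l) != (0, 0) -> X k l = 0.
    by rewrite xpair_eqE !mxE => /negPf ->; rewrite mulr0.
  have := nuclear_norm_single_le X0; rewrite (l1norm_single X0).
  rewrite !mxE !eqxx mulr1 -(real_normK (num_real t)); have := sqr_ge0 (`|t| - 1).
  by rewrite sqrrB; lra.
have /matrixP/(_ 0 0) := vertices_tangent Vx H.
by rewrite scaler0 !mxE !eqxx => /eqP; rewrite oner_eq0.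
Qed.

(** The direction 0 is tested with [c] the slack [1 - l1norm x - nuclear_norm x]: the bound holds as
    [c (1 + t) >= 0], and [0 = c x] kills the slack. *)
Lemma vertices_gauge_eq1 (R : realType) n m (x : 'M[R]_(n, m)) :
  vertices (@l1_nuclear_ball R n m) x -> x != 0 -> l1norm x + nuclear_norm x = 1.
Proof.
move=> Vx x0; have Bx : l1norm x + nuclear_norm x <= 1 by case: Vx.
apply/eqP; rewrite -subr_eq0 -oppr_eq0 opprB.
have : 0 = (1 - (l1norm x + nuclear_norm x)) *: x.
  apply: (vertices_tangent (K := 0) Vx) => t.
  rewrite scaler0 addr0 mul0r addr0 ler_norml => /andP[t1 _].
  have : 0 <= (1 - (l1norm x + nuclear_norm x)) * (1 + t) by apply: mulr_ge0; lra.
  by lra.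
by move/esym/eqP; rewrite scaler_eq0 (negPf x0) orbF.
Qed.

(** The point [x] is interior to its own normal cone. For [v] near [x] and [w = <v, x>],
    [<v, y> <= w (l1norm y + |y i j|) <= w] on the ball. *)
Lemma single_vertices (R : realType) n m (x : 'M[R]_(n, m)) i j :
  `|x i j| = 2^-1 -> (forall k l, (k, l) != (i, j) -> x k l = 0) ->
  vertices (@l1_nuclear_ball R n m) x.
Proof.
move=> xij x0; split.
  rewrite /l1_nuclear_ball /= (l1norm_single x0).
  by have := nuclear_norm_single_le x0; rewrite xij; lra.
exists x; apply/nbhs_ballP; exists (8^-1); first by rewrite /= invr_gt0.
move=> v [_ xv] y; rewrite /l1_nuclear_ball /= => By.
have vx k l : `|x k l - v k l| < 8^-1 by exact: xv.
pose w := mxdot v x.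
have wE : w = v i j * x i j.
  rewrite /w mxdotE (bigD1 (i, j)) //= big1 ?addr0 // => -[k l] /= kl.
  by rewrite x0 ?mulr0.
(* [<x, x> = 1/4], and replacing [x] by [v] costs at most [1/8 * 1/2]. Thus [w] exceeds 1/8, the
   bound on the other entries of [v]. *)
have w3 : 3 / 16 <= w.
  have : `|(x i j - v i j) * x i j| <= 8^-1 * 2^-1.
    by rewrite normrM xij ler_pM2r ?invr_gt0 // ltW.
  have : x i j * x i j = 2^-1 ^+ 2 by rewrite -xij real_normK ?num_real.
  rewrite ler_norml wE mulrBl => -> /andP[]; lra.
have vij : `|v i j| = 2 * w.
  have : `|w| = `|v i j| / 2 by rewrite wE normrM xij.
  by rewrite ger0_norm; lra.
have le_nuc := norm_le_nuclear_norm y i j.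
rewrite mxdotBr -/w subr_le0.
(* Entry [(i, j)] is counted twice on the right, which matches [|v i j| = 2 w]. *)
suff : mxdot v y <= w * (l1norm y + `|y i j|).
  have : 0 <= w * (1 - (l1norm y + `|y i j|)) by apply: mulr_ge0; lra.
  by lra.
rewrite mxdotE l1norm_pair (bigD1 (i, j)) //= [X in w * (X + _)](bigD1 (i, j)) //=.
have h1 : v i j * y i j <= 2 * w * `|y i j| by rewrite -vij -normrM ler_norm.
set s1 := \sum_(p | _) _; set s2 := \sum_(p | _) _.
suff : s1 <= w * s2 by lra.
rewrite mulr_sumr; apply: ler_sum => -[k l] /= kl.
apply: le_trans (ler_norm _) _; rewrite normrM ler_wpM2r //.
have := vx k l; rewrite x0 // sub0r normrN; lra.
Qed.

(** * Extreme points of the scaled entrywise ball *)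

Lemma scaled_l1_ballE (R : realType) n m :
  [set 2^-1 *: Y | Y in @l1_ball R n m] = [set X | l1norm X <= 2^-1].
Proof.
apply/seteqP; split=> [_ [Y YB <-]|X XB] /=.
  rewrite l1normZ gtr0_norm ?invr_gt0 // -[leRHS]mulr1 ler_pM2l ?invr_gt0 //.
exists (2 *: X); last by rewrite scalerA mulVf ?pnatr_eq0 // scale1r.
by rewrite /l1_ball /= l1normZ gtr0_norm // mulrC -ler_pdivlMr // div1r.
Qed.

Lemma l1norm_le_single (R : realType) n m (x : 'M[R]_(n, m)) i j :
  l1norm x <= `|x i j| -> forall k l, (k, l) != (i, j) -> x k l = 0.
Proof.
move=> xl k l kl; apply/normr0_eq0/le_anti.
by rewrite normr_ge0 andbT; have := l1norm_ge2 x kl; lra.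
Qed.

(** A nonzero entry of absolute value below 1/2 allows [x] to be split into a single-entry matrix of
    norm 1/2 and the rescaled rest, with weight [2 |x i j|] on the former. Conversely, an entry
    [1/2] or [-1/2] is extremal among scalars and exhausts the norm. *)
Lemma extreme_points_scaled_l1_ballP (R : realType) n m (x : 'M[R]_(n, m)) :
  (0 < n)%N -> (0 < m)%N ->
  extreme_points [set 2^-1 *: Y | Y in @l1_ball R n m] x <->
  exists i j, `|x i j| = 2^-1 /\ forall k l, (k, l) != (i, j) -> x k l = 0.
Proof.
move=> n0 m0; rewrite scaled_l1_ballE; split=> [[/= Bx Ex]|[i [j [xij x0]]]].
  pose u (i : 'I_n) (j : 'I_m) (c : R) := c *: delta_mx i j : 'M[R]_(n, m).
  have u0 i j c k l : (k, l) != (i, j) -> u i j c k l = 0.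
    by rewrite xpair_eqE !mxE => /negPf ->; rewrite mulr0.
  have uc i j c : u i j c i j = c by rewrite !mxE !eqxx mulr1.
  have u1 i j c : l1norm (u i j c) = `|c| by rewrite (l1norm_single (u0 i j c)) uc.
  have [i [j xij]] : exists i j, x i j != 0.
    apply: mx_neq0_entry; apply/eqP => x0.
    pose i := Ordinal n0; pose j := Ordinal m0.
    (* The zero matrix is the midpoint of two opposite points of the ball. *)
    have [/matrixP/(_ i j)] : u i j 2^-1 = x /\ u i j (- 2^-1) = x.
      apply: (Ex _ _ 2^-1).
    - by rewrite /= u1 gtr0_norm // invr_gt0.
    - by rewrite /= u1 normrN gtr0_norm // invr_gt0.
    - by apply/andP; split; lra.
    - rewrite x0 /u scaleNr scalerN -scalerBl (_ : _ - _ = 0) ?scale0r //.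
      lra.
    by rewrite x0 uc mxE => /eqP; rewrite invr_eq0 pnatr_eq0.
  exists i, j; have a0 : 0 < `|x i j| by rewrite normr_gt0.
  have leij := l1norm_ge x i j.
  have [aE|aN] := eqVneq `|x i j| 2^-1.
    by split=> //; apply: l1norm_le_single; rewrite aE.
  have a1 : 0 < 1 - 2 * `|x i j| by move/eqP: aN; lra.
  (* The rest has norm at most [1/2 - |x i j|], so this scaling keeps [z] in the ball. *)
  pose z := (1 - 2 * `|x i j|)^-1 *: (x - u i j (x i j)).
  have xz : l1norm (x - u i j (x i j)) = l1norm x - `|x i j|.
    rewrite !l1norm_pair (bigD1 (i, j)) //= [in RHS](bigD1 (i, j)) //=.
    rewrite addrAC subrr add0r mxE [(- u _ _ _) _ _]mxE uc subrr normr0 add0r.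
    by apply: eq_bigr => -[k l] kl; rewrite mxE [(- u _ _ _) _ _]mxE u0 //= subr0.
  have [/matrixP/(_ i j) + _] : u i j (Num.sg (x i j) / 2) = x /\ z = x.
    apply: (Ex _ _ (2 * `|x i j|)).
  - by rewrite /= u1 normrM normr_sg xij mul1r gtr0_norm // invr_gt0.
  - rewrite /= l1normZ xz gtr0_norm ?invr_gt0 // mulrC ler_pdivrMr //; lra.
  - by apply/andP; split; lra.
  - have -> : (1 - 2 * `|x i j|) *: z = x - u i j (x i j).
      by rewrite scalerA mulfV ?gt_eqF // scale1r.
    have -> : (2 * `|x i j|) *: u i j (Num.sg (x i j) / 2) = u i j (x i j).
      rewrite /u scalerA; congr (_ *: _); rewrite [RHS]numEsg; by field.
    by rewrite addrC subrK.
  rewrite uc => /(congr1 Num.norm); rewrite normrM normr_sg xij mul1r.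
  by rewrite gtr0_norm ?invr_gt0 // => h; rewrite h eqxx in aN.
split=> /=; first by rewrite (l1norm_single x0) xij.
have key y : l1norm y <= 2^-1 -> y i j = x i j -> y = x.
  move=> ly yx; have y0 : forall k l, (k, l) != (i, j) -> y k l = 0.
    by apply: l1norm_le_single; rewrite yx xij.
  apply/matrixP => k l; have [[-> ->] //|kl] := eqVneq (k, l) (i, j).
  by rewrite x0 // y0.
move=> y z t By Bz /andP[t0 t1] xE.
have yl := le_trans (l1norm_ge y i j) By.
have zl := le_trans (l1norm_ge z i j) Bz.
have xijE : x i j = t * y i j + (1 - t) * z i j by rewrite {1}xE !mxE.
suff [yE zE] : y i j = x i j /\ z i j = x i j by split; apply: key.
move: yl zl xijE xij; rewrite !ler_norml => /andP[y1 y2] /andP[z1 z2] xijE.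
move/norm_eq_half => [] xh; rewrite xh in xijE *.
  by apply: convex_comb_eq_ub (esym xijE); rewrite ?t0.
have [yE zE] : - y i j = 2^-1 /\ - z i j = 2^-1.
  by apply: (@convex_comb_eq_ub _ _ _ _ t); rewrite ?t0 //; lra.
by split; lra.
Qed.

(** * Characterization of the vertices *)

(** Only one entry of a vertex survives; both norms then equal its absolute value, and their sum is
    1. *)
Lemma vertices_l1_nuclear_ballP (R : realType) n m (x : 'M[R]_(n, m)) :
  (0 < n)%N -> (0 < m)%N ->
  vertices (@l1_nuclear_ball R n m) x <->
  exists i j, `|x i j| = 2^-1 /\ forall k l, (k, l) != (i, j) -> x k l = 0.
Proof.
move=> n0 m0; split=> [Vx|[i [j [xij x0]]]]; last exact: single_vertices xij x0.
have nz := vertices_neq0 n0 m0 Vx.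
have [i [j xij]] := mx_neq0_entry nz.
have x0 k l : (k, l) != (i, j) -> x k l = 0.
  rewrite xpair_eqE negb_and => /orP[]; first exact: vertices_row Vx xij.
  exact: vertices_col Vx xij.
exists i, j; split=> //; have := vertices_gauge_eq1 Vx nz.
have := norm_le_nuclear_norm x i j; have := nuclear_norm_single_le x0.
by rewrite (l1norm_single x0); lra.
Qed.

Theorem theorem3p7 (R : realType) (n m : nat) (n_gt0 : (0 < n)%N)
    (le_nm : (n <= m)%N) :
  vertices (@l1_nuclear_ball R n m) =
    extreme_points [set 2^-1 *: Y | Y in @l1_ball R n m] /\
  vertices (@l1_nuclear_ball R n m) =
    [set X : 'M[R]_(n, m) | exists (i : 'I_n) (j : 'I_m),
       (X i j = 2^-1 \/ X i j = - 2^-1) /\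
       forall k l, (k, l) != (i, j) -> X k l = 0].
Proof.
have m_gt0 : (0 < m)%N := leq_trans n_gt0 le_nm.
split; apply/funext => X; apply/propext.
  by rewrite vertices_l1_nuclear_ballP // extreme_points_scaled_l1_ballP.
rewrite vertices_l1_nuclear_ballP //.
by split=> -[i [j [/norm_eq_half Xij X0]]]; exists i, j.
Qed.
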